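(* Let $\ell$ be a prime power and fix an integer $r \geq 0$. For large enough $n$ and for large enough even $c$, let $C$ be a fixed alternating form on $\mathbb{F}_\ell^n$ of rank $c$, and let $M$ be a uniformly random $C$-symmetric $n\times n$ matrix over $\mathbb{F}_\ell$. Then \[ |\mathbb{P}[\dim \ker M = r] - p_r(n)| = O_{\ell, r}(n\ell^{-c}), \] where $p_r(n)$ is the probability that a uniformly random $n\times n$ matrix over $\mathbb{F}_\ell$ (entries i.i.d. uniform in $\mathbb{F}_\ell$) has $r$-dimensional kernel.
   Context: An alternating form $C$ on $\mathbb{F}_\ell^n$ is identified with its matrix, a skew-symmetric $n\times n$ matrix over $\mathbb{F}_\ell$ with zeros on the diagonal. An $n\times n$ matrix $M$ over $\mathbb{F}_\ell$ is called $C$-symmetric if $M-M^\intercal=C$. The notation $O_{\ell,r}$ means that the implied constant (and the thresholds for ''large enough'') depend only on $\ell$ and $r$; in particular the bound is uniform in $n$, $c$ and $C$. *)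

(* Defs.v *)
From HB Require Import structures.
From mathcomp Require Import all_boot all_order all_algebra.
Set Implicit Arguments.
Unset Strict Implicit.
Unset Printing Implicit Defensive.

Import Order.TTheory GRing.Theory Num.Theory.
Local Open Scope ring_scope.

Definition prime_power (q : nat) : Prop :=
  exists p k : nat, [/\ prime p, (0 < k)%N & q = (p ^ k)%N].

Definition unif_prob (T : finType) (A E : {set T}) : rat :=
  #|A :&: E|%:R / #|A|%:R.

Definition alternating_mx (F : fieldType) (n : nat) (C : 'M[F]_n) : Prop :=
  C^T = - C /\ (forall i : 'I_n, C i i = 0).

(* Matrices act on column vectors, whereas kermx is the kernel of the right
   action on row vectors: the rows of kermx M^T span { v^T | M *m v = 0 }. *)
Definition dim_ker (F : fieldType) (n : nat) (M : 'M[F]_n) : nat :=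
  \rank (kermx M^T).

Definition Csymmetric (F : finFieldType) (n : nat) (C : 'M[F]_n) :
  {set 'M[F]_n} := [set M | M - M^T == C].

Definition corank_set (F : finFieldType) (n r : nat) : {set 'M[F]_n} :=
  [set M | dim_ker M == r].

Definition p_ker (F : finFieldType) (r n : nat) : rat :=
  unif_prob [set: 'M[F]_n] (corank_set F n r).

(* Main.v *)
(** Write q for the cardinality of the field. The number of injective k-tuples
    of vectors in a d-dimensional space is the polynomial
    prod_(j < k) (q^d - q^j) in q^d, and a q-binomial inversion expresses the
    indicator of d = r as a linear combination of these numbers. Hence the law of
    dim ker M is determined by the expected numbers of linearly independent
    k-tuples in the kernel. For a uniform matrix this expectation is
    prod_(j < k) (q^n - q^j) / q^(nk). For a C-symmetric matrix a given
    independent tuple V is killed with probability q^(C(k,2) - nk) if it is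
    isotropic for C, and with probability 0 otherwise. Isotropic tuples are
    counted by extending them one vector at a time: the number of extensions is
    the generic one unless the span of V meets ker C, which is rare as C has rank
    c. This gives a relative error O(q^(C(k+1,2) - c)) in the k-th moment, and
    the coefficients of the inversion decay fast enough for each of the n + 1
    terms to contribute O(q^-c). *)

Require Import Defs.
From mathcomp Require Import all_boot all_order all_algebra.
From mathcomp Require Import mxabelem ring lra zify.
Set Implicit Arguments.
Unset Strict Implicit.
Unset Printing Implicit Defensive.
Import Order.TTheory GRing.Theory Num.Theory.
Local Open Scope ring_scope.

(** * q-falling products, q-binomial inversion and bounds on its coefficients *)

Section QSeries.

Variable R : realFieldType.
Implicit Types (q : R) (d i j k m r N : nat).

Definition qfall q d k : R := \prod_(j < k) (q ^+ d - q ^+ j).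

Definition qprod q i : R := \prod_(j < i) (q ^+ j.+1 - 1).

(** As [qfall q i i] is q^C(i,2) [qprod q i], this equals (-1)^i q^C(i,2) [r+i choose r]_q /
    [qfall q (r + i) (r + i)], the classical q-binomial inversion coefficient. *)
Definition inv_coef q r i : R :=
  (-1) ^+ i / (q ^+ (r * i) * qfall q r r * qprod q i).

Lemma qfall_eq0 q d k : (d < k)%N -> qfall q d k = 0.
Proof.
by move=> dk; rewrite /qfall (bigD1 (Ordinal dk)) //= subrr mul0r.
Qed.

Lemma qfallS q d k : qfall q d k.+1 = qfall q d k * (q ^+ d - q ^+ k).
Proof. by rewrite /qfall big_ord_recr. Qed.

(** Each of the last i factors carries q^r, since q^(r+m) - q^(r+j) = q^r (q^m - q^j). This reduces
    inversion at r to inversion at 0. *)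
Lemma qfallD q r m i :
  qfall q (r + m) (r + i) = qfall q (r + m) r * (q ^+ (r * i) * qfall q m i).
Proof.
rewrite /qfall big_split_ord /=; congr (_ * _).
rewrite exprM -[in q ^+ r ^+ i](card_ord i) -prodr_const -big_split /=.
by apply: eq_bigr => j _; rewrite !exprD mulrBr.
Qed.

Lemma qfall_gt0 q d k : 1 < q -> (k <= d)%N -> 0 < qfall q d k.
Proof.
move=> q1 kd; apply: prodr_gt0 => j _.
by rewrite subr_gt0 ltr_eXn2l // (leq_trans (ltn_ord j)).
Qed.

Lemma qfall_ge0 q d k : 1 < q -> 0 <= qfall q d k.
Proof.
move=> q1; case: (leqP k d) => [kd|dk]; first exact/ltW/qfall_gt0.
by rewrite qfall_eq0.
Qed.

Lemma qfall_le q d k : 1 < q -> qfall q d k <= q ^+ (d * k).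
Proof.
move=> q1; have q0 : 0 <= q by lra.
case: (leqP k d) => [kd|dk]; last by rewrite qfall_eq0 // exprn_ge0.
rewrite exprM -[in leRHS](card_ord k) -prodr_const.
apply: ler_prod => j _.
rewrite subr_ge0 ler_eXn2l // (leq_trans (ltnW (ltn_ord j)) kd) /=.
by rewrite gerBl exprn_ge0.
Qed.

Lemma qprod_gt0 q i : 1 < q -> 0 < qprod q i.
Proof. by move=> q1; apply: prodr_gt0 => j _; rewrite subr_gt0 exprn_egt1. Qed.

Lemma qfall_ge1 q r : 2 <= q -> 1 <= qfall q r r.
Proof.
move=> q2; rewrite /qfall.
elim/big_ind: _ => // [x y x1 y1|j _]; first exact: mulr_ege1.
have q0 : 0 <= q by lra.
have q1 : 1 <= q by lra.
rewrite -[X in q ^+ X - _](subnKC (ltn_ord j)) exprD exprS.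
have := exprn_ege1 j q1; have := exprn_ege1 (r - j.+1) q1.
set a := q ^+ j; set b := q ^+ (r - _) => b1 a1.
have : 0 <= (q - 2) * (a * b) by rewrite !mulr_ge0; lra.
nra.
Qed.

(* The invariant [1/4 + q^-i/2] is what makes the induction close: the infinite
   product of [1 - 2^-j] is only slightly larger than [1/4]. *)
Lemma qprod_ge q i : 2 <= q -> q ^+ 'C(i.+1, 2) <= 4 * qprod q i.
Proof.
move=> q2; have q0 : 0 < q by lra.
have qn0 k : q ^+ k != 0 by rewrite expf_neq0 // gt_eqF.
case: i => [|i]; first by rewrite bin_small // expr0 /qprod big_ord0; lra.
suff : q ^+ 'C(i.+2, 2) * (1 / 4 + (q ^+ i.+1)^-1 / 2) <= qprod q i.+1.
  have : 0 <= q ^+ 'C(i.+2, 2) * ((q ^+ i.+1)^-1 / 2).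
    by rewrite mulr_ge0 ?divr_ge0 ?invr_ge0 ?exprn_ge0 ?(ltW q0).
  by rewrite mulrDr; lra.
elim: i => [|i IH].
  rewrite /qprod big_ord1 binn !expr1 mulrDr mulrA [q * (q^-1 / 2)]mulrA divff ?gt_eqF //.
  lra.
rewrite /qprod big_ord_recr /= -/(qprod q i.+1).
rewrite [in leLHS]binS bin1 exprD.
have y0 : 0 < (q ^+ i.+1)^-1 by rewrite invr_gt0 exprn_gt0.
have qx : q * q ^+ i.+1 = q ^+ i.+2 by rewrite -exprS.
have xy : q ^+ i.+1 * (q ^+ i.+1)^-1 = 1 by rewrite divff.
have x2 : 2 <= q ^+ i.+1.
  rewrite exprS; have q1 : 1 <= q by lra.
  by have := exprn_ege1 i q1; nra.
have z1 : (q ^+ i.+2)^-1 * q = (q ^+ i.+1)^-1.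
  by rewrite -qx invfM mulrAC mulVf ?gt_eqF ?mul1r.
have zx : q ^+ i.+2 * (q ^+ i.+2)^-1 = 1 by rewrite divff.
move: IH; rewrite -qx in zx *.
set P := q ^+ 'C(_, 2); set y := (q ^+ i.+1)^-1 in y0 xy z1 *.
have P0 : 0 < P by rewrite exprn_gt0.
set x := q ^+ i.+1 in x2 xy zx *.
move=> IH; apply: (@le_trans _ _ (P * (1 / 4 + y / 2) * (q * x - 1))); last first.
  by rewrite ler_wpM2r //; nra.
rewrite -[leLHS]mulrA -[leRHS]mulrA ler_pM2l //.
have -> : q * x * (1 / 4 + (q * x)^-1 / 2) = q * x / 4 + (q * x / (q * x)) / 2.
  by ring.
have -> : (1 / 4 + y / 2) * (q * x - 1) =
  q * x / 4 - 1 / 4 + q * (x * y) / 2 - y / 2 by field.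
rewrite zx xy; nra.
Qed.

(** The q-analogue of sum_(i <= N) (-1)^i binom(m, i) = (-1)^N binom(m-1, N). *)
Lemma alternating_qsum q m N : 1 < q ->
  \sum_(i < N.+1) (-1) ^+ i * (qfall q m i / qprod q i) =
  (-1) ^+ N * ((\prod_(j < N) (q ^+ m - q ^+ j.+1)) / qprod q N).
Proof.
move=> q1; elim: N => [|N IH].
  by rewrite big_ord1 /qfall !big_ord0.
rewrite big_ord_recr /= IH big_ord_recr /= /qfall big_ord_recl /= expr0.
have -> : qprod q N.+1 = qprod q N * (q ^+ N.+1 - 1).
  by rewrite /qprod big_ord_recr.
set P := \prod_(_ < _) _; rewrite exprS.
have /gt_eqF/negbT p0 := qprod_gt0 N q1.
have s0 : q ^+ N.+1 - 1 != 0 by rewrite gt_eqF // subr_gt0 exprn_egt1.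
by field; apply/andP.
Qed.

Lemma qfall_inversion q r d N : 1 < q -> (d <= r + N)%N ->
  \sum_(i < N.+1) inv_coef q r i * qfall q d (r + i) = (d == r)%:R.
Proof.
move=> q1 dN; case: (ltnP d r) => [dr|].
  rewrite ltn_eqF // big1 // => i _.
  by rewrite qfall_eq0 ?mulr0 // (leq_trans dr) // leq_addr.
move=> rd; move: dN; rewrite -(subnKC rd) leq_add2l; move: (d - r)%N => m dN.
have /gt_eqF/negbT r0 := qfall_gt0 q1 (leqnn r).
transitivity (qfall q (r + m) r / qfall q r r *
   \sum_(i < N.+1) (-1) ^+ i * (qfall q m i / qprod q i)).
  rewrite mulr_sumr; apply: eq_bigr => i _.
  rewrite /inv_coef qfallD.
  have /gt_eqF/negbT p0 := qprod_gt0 i q1.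
  have s0 : q ^+ (r * i) != 0 by rewrite expf_neq0 // gt_eqF; lra.
  by field; rewrite p0 r0.
rewrite alternating_qsum // -[X in (_ == X)%:R](addn0 r) eqn_add2l.
(* At 0 the signs turn the product into [qprod q N]; at a positive value at most N one factor of the
   product vanishes. *)
case: m dN => [|m] mN.
  rewrite addn0 divff // mul1r eqxx /=.
  have /gt_eqF/negbT p0 := qprod_gt0 N q1.
  rewrite -[N in (-1) ^+ N](card_ord N) -prodr_const mulrA -big_split /=.
  rewrite (eq_bigr (fun j : 'I_N => q ^+ j.+1 - 1)) ?divff // => j _.
  by rewrite mulN1r opprB.
by rewrite (bigD1 (Ordinal mN)) //= subrr !(mul0r, mulr0).
Qed.

(** This decay in i is exactly what offsets the growth of the moment error at k = r + i. *)
Lemma inv_coef_le q r i : 2 <= q ->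
  `|inv_coef q r i| <= 4 / (q ^+ (r * i) * q ^+ 'C(i.+1, 2)).
Proof.
move=> q2; have q1 : 1 < q by lra.
have q0 : 0 < q by lra.
rewrite /inv_coef normrM normrX normrN1 expr1n mul1r normfV.
have p0 := qprod_gt0 i q1; have r0 := qfall_gt0 q1 (leqnn r).
have s0 : 0 < q ^+ (r * i) by rewrite exprn_gt0.
have t0 : 0 < q ^+ 'C(i.+1, 2) by rewrite exprn_gt0.
rewrite gtr0_norm; last by rewrite !mulr_gt0.
rewrite ler_pdivlMr ?mulr_gt0 // mulrC ler_pdivrMr ?mulr_gt0 //.
have := qprod_ge i q2; have := qfall_ge1 r q2.
set a := q ^+ (r * i) in s0 *; set b := q ^+ _ in t0 *.
set c := qfall _ _ _ in r0 *; set e := qprod _ _ in p0 * => c1 bc.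
have -> : 4 * (a * c * e) = a * (c * (4 * e)) by ring.
rewrite ler_pM2l //; nra.
Qed.

End QSeries.

(** * Alternating matrices in any characteristic *)

Lemma alternating_mxP (K : fieldType) n (C : 'M[K]_n) :
  alternating_mx C <-> exists A : 'M[K]_n, C = A - A^T.
Proof.
split=> [[CT C0]|[A ->]]; last first.
  split; last by move=> i; rewrite !mxE subrr.
  by rewrite linearB /= trmxK opprB.
(* The strictly lower triangular part of C; the zero diagonal makes it work in characteristic 2 as
   well. *)
exists (\matrix_(i, j) if (j < i)%N then C i j else 0).
apply/matrixP => i j; rewrite !mxE.
case: (ltngtP i j) => [_|_|/val_inj ->]; rewrite ?subr0 ?sub0r ?C0 //.
by have := congr1 (fun X : 'M_n => X j i) CT; rewrite !mxE => ->.
Qed.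

Lemma alternating_mx_conj (K : fieldType) m n (C : 'M[K]_n) (W : 'M[K]_(m, n)) :
  alternating_mx C -> alternating_mx (W *m C *m W^T).
Proof.
move=> /alternating_mxP[A ->]; apply/alternating_mxP; exists (W *m A *m W^T).
by rewrite !trmx_mul trmxK mulmxBr mulmxBl mulmxA.
Qed.

Lemma alternating_mx_self (K : fieldType) n (C : 'M[K]_n) (w : 'rV[K]_n) :
  alternating_mx C -> w *m C *m w^T = 0.
Proof.
move=> /(alternating_mx_conj w)[_ w0].
by apply/matrixP => i j; rewrite !ord1 w0 mxE.
Qed.

Lemma alternating_drsubmx (K : fieldType) k m (C : 'M[K]_(k + m)) :
  alternating_mx C -> alternating_mx (drsubmx C).
Proof.
move=> /alternating_mxP[A ->]; apply/alternating_mxP; exists (drsubmx A).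
by apply/matrixP => i j; rewrite !mxE.
Qed.

(** * Counting independent tuples and matrices over a finite field *)

Section Counting.

Variable F : finFieldType.
Local Notation q := (#|F|%:R : rat).

Lemma card_field_ge2 : 2 <= q.
Proof. by rewrite ler_nat card_finNzRing_gt1. Qed.

Lemma card_submx m n (A : 'M[F]_(m, n)) :
  #|[set v : 'rV[F]_n | (v <= A)%MS]| = (#|F| ^ \rank A)%N.
Proof. by rewrite -card_rowg; apply: eq_card => v; rewrite !inE. Qed.

Lemma card_kermx m n (A : 'M[F]_(m, n)) :
  #|[set v : 'rV[F]_m | v *m A == 0]| = (#|F| ^ (m - \rank A))%N.
Proof.
by rewrite -mxrank_ker -card_submx; apply: eq_card => v; rewrite !inE sub_kermx.
Qed.

Lemma sum_col_mx k n (f : 'M[F]_(1 + k, n) -> rat) :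
  \sum_W f W = \sum_(V : 'M[F]_(k, n)) \sum_(v : 'rV[F]_n) f (col_mx v V).
Proof.
rewrite pair_big /=.
rewrite (reindex (fun p : 'M[F]_(k, n) * 'rV[F]_n => col_mx p.2 p.1)) //.
exists (fun W => (dsubmx W, usubmx W)) => [[V v] _|W _] /=.
  by rewrite col_mxKd col_mxKu.
by rewrite vsubmxK.
Qed.

Lemma natr_card_set (T : finType) (P : pred T) :
  #|[set x | P x]|%:R = \sum_x (P x)%:R :> rat.
Proof.
rewrite -sum1_card natr_sum [RHS](bigID P) /= [X in _ + X]big1 ?addr0.
  by apply: eq_big => [x|x]; rewrite inE // => ->.
by move=> x /negbTE ->.
Qed.

Lemma row_free_col_mx k n (v : 'rV[F]_n) (V : 'M[F]_(k, n)) :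
  row_free (col_mx v V) = row_free V && ~~ (v <= V)%MS.
Proof.
rewrite /row_free -addsmxE.
have [vV|vV] /= := boolP (v <= V)%MS.
  rewrite andbF; apply/negbTE; rewrite neq_ltn ltnS.
  by rewrite (leq_trans (mxrankS _) (rank_leq_row V)) // addsmx_sub vV submx_refl.
rewrite andbT; have rV := rank_leq_row V.
have lt : (\rank V < \rank (v + V)%MS)%N.
  have := mxrank_leqif_sup (addsmxSr v V).
  rewrite addsmx_sub submx_refl andbT => /ltn_leqif ->; exact: vV.
have le : (\rank (v + V)%MS <= 1 + \rank V)%N.
  by rewrite (leq_trans (mxrank_adds_leqif v V)) // leq_add2r rank_leq_row.
by apply/eqP/eqP; lia.
Qed.

(** Tuples grow by one vector at a time: v lies in the row space of A but outside that of V, leaving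
    q^(rank A) - q^k choices. *)
Lemma card_row_free_submx k m n (A : 'M[F]_(m, n)) :
  #|[set V : 'M[F]_(k, n) | row_free V && (V <= A)%MS]|%:R
    = qfall q (\rank A) k.
Proof.
elim: k => [|k IH].
  rewrite /qfall big_ord0 [X in X%:R](_ : _ = 1%N) //.
  rewrite -(card1 (0 : 'M[F]_(0, n))); apply: eq_card => V.
  by rewrite !inE [V]flatmx0 eqxx /row_free mxrank0 sub0mx.
rewrite qfallS -[k.+1]/(1 + k)%N natr_card_set sum_col_mx -IH natr_card_set mulr_suml.
apply: eq_bigr => V _.
under eq_bigr => v _ do rewrite row_free_col_mx col_mx_sub.
have [Vf|Vf] := boolP (row_free V); last by rewrite mul0r big1.
have [VA|VA] := boolP (V <= A)%MS; last by rewrite mul0r big1 // => v _; rewrite !andbF.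
rewrite mul1r /=; under eq_bigr => v _ do rewrite andbT.
have := card_submx V; have := card_submx A; rewrite (eqP Vf) => cA cV.
rewrite -!natrX -cA -cV !natr_card_set -sumrB; apply: eq_bigr => v _.
have [vV|vV] := boolP (v <= V)%MS; last by rewrite subr0.
by rewrite (submx_trans vV VA) subrr.
Qed.

Lemma card_row_free_kermx k n p (M : 'M[F]_(n, p)) :
  #|[set V : 'M[F]_(k, n) | row_free V && (V *m M == 0)]|%:R
    = qfall q (n - \rank M) k.
Proof.
rewrite -mxrank_ker -card_row_free_submx; congr _%:R.
by apply: eq_card => V; rewrite !inE sub_kermx.
Qed.

Lemma card_row_free k n :
  #|[set V : 'M[F]_(k, n) | row_free V]|%:R = qfall q n k.
Proof.
rewrite -[n in RHS](mxrank1 F n) -card_row_free_submx; congr _%:R.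
by apply: eq_card => V; rewrite !inE submx1 andbT.
Qed.

Lemma row_free_le k n (V : 'M[F]_(k, n)) : row_free V -> (k <= n)%N.
Proof. by move=> /eqP <-; rewrite rank_leq_col. Qed.

(** Up to an invertible left factor, V is the top of an invertible matrix, so a change of basis
    moves V to the first k unit vectors. *)
Lemma row_free_ebase k m (V : 'M[F]_(k, k + m)) : row_free V ->
  V = col_ebase V *m usubmx (row_ebase V).
Proof.
move=> /eqP rV; rewrite -[LHS]mulmx_ebase rV -mulmxA; congr (_ *m _).
rewrite pid_mx_row -[X in row_mx _ _ *m X]vsubmxK mul_row_col mul1mx.
by rewrite mul0mx addr0.
Qed.

Lemma row_free_mulmx_eq0 k m p (V : 'M[F]_(k, k + m)) (M : 'M[F]_(k + m, p)) :
  row_free V -> (V *m M == 0) = (usubmx (row_ebase V *m M) == 0).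
Proof.
move=> fV; rewrite {1}(row_free_ebase fV) -mulmxA mul_usub_mx.
apply/eqP/eqP => [|->]; last by rewrite mulmx0.
by move=> /(congr1 (mulmx (invmx (col_ebase V)))); rewrite mulKmx ?col_ebase_unit // mulmx0.
Qed.

Lemma card_mulmx_eq0 k n p (V : 'M[F]_(k, n)) : row_free V ->
  #|[set M : 'M[F]_(n, p) | V *m M == 0]| = (#|F| ^ ((n - k) * p))%N.
Proof.
move=> fV; have /subnKC := row_free_le fV; move: (n - k)%N => m nE.
move: V fV; rewrite -{n}nE => V fV.
pose f (M : 'M[F]_(k + m, p)) := row_ebase V *m M.
have f_inj : injective f.
  exact: can_inj (mulKmx (row_ebase_unit V)).
have g_inj : injective (fun D : 'M[F]_(m, p) => col_mx (0 : 'M[F]_(k, p)) D).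
  by move=> D D' /eq_col_mx[].
have -> : [set M : 'M[F]_(k + m, p) | V *m M == 0] =
          f @^-1: [set col_mx 0 D | D : 'M[F]_(m, p)].
  apply/setP => M; rewrite !inE row_free_mulmx_eq0 //.
  apply/eqP/imsetP => [u0|[D _]]; last by rewrite /f => ->; rewrite col_mxKu.
  by exists (dsubmx (f M)) => //; rewrite -u0 vsubmxK.
by rewrite card_preimset // card_imset // card_mx.
Qed.

(** Split off the first row and column: the corner and the left column are free, the top row is then
    determined, and the remaining block is symmetric for the matching block of C. At size n + 1 this
    gives 1 + n + C(n+1,2) = C(n+2,2) free entries. *)
Lemma card_Csymmetric n (C : 'M[F]_n) : alternating_mx C ->
  #|Csymmetric C| = (#|F| ^ 'C(n.+1, 2))%N.
Proof.
elim: n C => [|n IH] C.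
  rewrite bin_small // expn0 -(card1 (0 : 'M[F]_0)) => _; apply: eq_card => M.
  by rewrite !inE [M]flatmx0 [C]flatmx0 [X in X == 0]flatmx0 !eqxx.
suff IHS (C' : 'M[F]_(1 + n)) : alternating_mx C' ->
    #|Csymmetric C'| = (#|F| ^ 'C(n.+2, 2))%N by exact: IHS.
move=> {C} altC; have drC := alternating_drsubmx altC; have [CT C0] := altC.
have ulC : ulsubmx C' = 0.
  by apply/matrixP => i j; rewrite !ord1 !mxE C0.
have dlC : dlsubmx C' = - (ursubmx C')^T.
  by rewrite trmx_ursub CT; apply/matrixP => i j; rewrite !mxE opprK.
pose f (x : ('M[F]_1 * 'M[F]_(n, 1)) * 'M[F]_n) :=
  block_mx x.1.1 (ursubmx C' + x.1.2^T) x.1.2 x.2.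
have f_inj : injective f.
  by move=> [[a b] D] [[a' b'] D'] /eq_block_mx/= [-> _ -> ->].
have -> : Csymmetric C' =
    f @: setX [set: 'M[F]_1 * 'M[F]_(n, 1)] (Csymmetric (drsubmx C')); last first.
  rewrite card_imset // cardsX IH // cardsT card_prod !card_mx !muln1.
  by rewrite [in RHS]binS bin1 -!expnD addnC add1n.
apply/setP => M; apply/idP/imsetP => [|[[[a b] D]]]; rewrite !inE /=.
  move=> /eqP MC; exists ((ulsubmx M, dlsubmx M), drsubmx M); last first.
    rewrite /f /= -MC -[LHS]submxK; congr block_mx.
    by rewrite trmx_dlsub; apply/matrixP => i j; rewrite !mxE subrK.
  by rewrite !inE /= -MC; apply/eqP/matrixP => i j; rewrite !mxE.
move=> /eqP DC ->; rewrite /f /= tr_block_mx opp_block_mx add_block_mx.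
apply/eqP; rewrite -[RHS]submxK ulC dlC -DC linearD /= trmxK addrK.
congr block_mx; last by rewrite opprD addrCA subrr addr0.
by apply/matrixP => i j; rewrite !ord1 !mxE subrr.
Qed.

(** If V M = 0, then V C V^T = V M V^T - (V M V^T)^T = 0, so V is isotropic. For isotropic V, a
    congruence moves V to the first k unit vectors, and only a lower right block of size n - k stays
    undetermined. *)
Lemma card_Csymmetric_mulmx_eq0 k n (C : 'M[F]_n) (V : 'M[F]_(k, n)) :
  alternating_mx C -> row_free V ->
  #|[set M in Csymmetric C | V *m M == 0]| =
  ((V *m C *m V^T == 0)%R * #|F| ^ 'C((n - k).+1, 2))%N.
Proof.
move=> altC fV; have /subnKC := row_free_le fV; move: (n - k)%N => m nE.
move: C altC V fV; rewrite -{n}nE => C [CT C0] V fV.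
pose Q := row_ebase V.
have Qu : Q \in unitmx by exact: row_ebase_unit.
have QTu : Q^T \in unitmx by rewrite unitmx_tr.
pose f (M : 'M[F]_(k + m)) := Q *m M *m Q^T.
have f_inj : injective f by move=> M M' /(can_inj (mulmxK QTu))/(can_inj (mulKmx Qu)).
have fsub M : f M - (f M)^T = f (M - M^T).
  by rewrite /f !trmx_mul trmxK mulmxA -mulmxBl -mulmxBr.
have fV0 M : (V *m M == 0) = (usubmx (f M) == 0).
  rewrite row_free_mulmx_eq0 // -(mul_usub_mx (Q *m M)); apply/eqP/eqP => [->|].
    by rewrite mul0mx.
  by move=> /(congr1 (mulmx^~ (invmx Q^T))); rewrite mulmxK // mul0mx.
have altfC : alternating_mx (f C) by exact: alternating_mx_conj.
have VC0 : (V *m C *m V^T == 0) = (ulsubmx (f C) == 0).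
  have -> : ulsubmx (f C) = usubmx Q *m C *m (usubmx Q)^T.
    by rewrite /f /ulsubmx -!mul_usub_mx -mulmx_lsub trmx_usub.
  pose L := col_ebase V.
  have Lu : L \in unitmx by exact: col_ebase_unit.
  have LTu : L^T \in unitmx by rewrite unitmx_tr.
  have -> : V *m C *m V^T = L *m (usubmx Q *m C *m (usubmx Q)^T) *m L^T.
    by rewrite {1 2}(row_free_ebase fV) trmx_mul !mulmxA.
  apply/eqP/eqP => [|->]; last by rewrite mulmx0 mul0mx.
  move=> /(congr1 (mulmx^~ (invmx L^T)))/(congr1 (mulmx (invmx L))).
  by rewrite mulmxK // mulKmx // mul0mx mulmx0.
have -> : [set M in Csymmetric C | V *m M == 0] =
  f @^-1: [set M in Csymmetric (f C) | usubmx M == 0].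
  by apply/setP => M; rewrite !inE fV0 fsub (inj_eq f_inj).
rewrite card_preimset // VC0.
move: (f C) altfC => C' altC'; have [C'T _] := altC'.
have urC' : ursubmx C' = - (dlsubmx C')^T.
  by rewrite trmx_dlsub C'T; apply/matrixP => i j; rewrite !mxE opprK.
have [ul0|ul0] := eqVneq (ulsubmx C') 0; last first.
  rewrite mul0n; apply: eq_card0 => M; rewrite !inE; apply/negbTE/negP.
  move=> /andP[/eqP MC /eqP u0]; case/eqP: ul0.
  have -> : ulsubmx C' = ulsubmx M - (ulsubmx M)^T.
    by rewrite -MC; apply/matrixP => i j; rewrite !mxE.
  by rewrite /ulsubmx u0 linear0 trmx0 subr0.
rewrite mul1n -(card_Csymmetric (alternating_drsubmx altC')).
(* Zero top rows force the lower left block to be that of [C']. *)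
pose g (D : 'M[F]_m) := block_mx (0 : 'M[F]_k) 0 (dlsubmx C') D.
have g_inj : injective g by move=> D D' /eq_block_mx[].
rewrite -(card_imset _ g_inj); apply: eq_card => M.
rewrite !inE; apply/andP/imsetP => [[/eqP MC /eqP u0]|[D]].
  have [ulM urM] : ulsubmx M = 0 /\ ursubmx M = 0.
    by rewrite /ulsubmx /ursubmx u0 !linear0.
  exists (drsubmx M); first by rewrite inE -MC; apply/eqP/matrixP => i j; rewrite !mxE.
  rewrite /g -[LHS]submxK ulM urM; congr block_mx.
  have -> : dlsubmx C' = dlsubmx M - (ursubmx M)^T.
    by rewrite -MC; apply/matrixP => i j; rewrite !mxE.
  by rewrite urM trmx0 subr0.
rewrite inE => /eqP DC ->; rewrite /g tr_block_mx opp_block_mx add_block_mx.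
rewrite block_mxEv col_mxKu row_mx0; split=> //.
apply/eqP; rewrite -[RHS]submxK ul0 urC' -DC -block_mxEv !trmx0.
by congr block_mx; rewrite ?subr0 ?add0r.
Qed.

End Counting.

(** * Moments of the kernel size as counts of independent tuples *)

Section Moments.

Variable F : finFieldType.
Local Notation q := (#|F|%:R : rat).

Lemma card_field_gt1 : 1 < q.
Proof. by have := card_field_ge2 F; lra. Qed.

Lemma card_field_gt0 : 0 < q.
Proof. by have := card_field_ge2 F; lra. Qed.

(** Double counting of pairs (M, V) with V independent and V M = 0; left and right kernels of M have
    the same dimension. *)
Lemma sum_qfall_corank n k (A : {set 'M[F]_n}) :
  \sum_(M in A) qfall q (n - \rank M) k =
  \sum_(V : 'M[F]_(k, n) | row_free V) #|[set M in A | V *m M == 0]|%:R.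
Proof.
under eq_bigr => M _ do rewrite -(card_row_free_kermx k M) natr_card_set.
rewrite exchange_big /= [RHS]big_mkcond /=; apply: eq_bigr => V _.
case: (row_free V) => /=; last by rewrite big1.
rewrite natr_card_set [LHS]big_mkcond /=; apply: eq_bigr => M _.
by case: (M \in A).
Qed.

Lemma mean_qfall_corank n k :
  (\sum_(M in [set: 'M[F]_n]) qfall q (n - \rank M) k) / #|[set: 'M[F]_n]|%:R
    = qfall q n k / q ^+ (n * k).
Proof.
rewrite sum_qfall_corank.
rewrite (eq_bigr (fun _ => 1 * q ^+ ((n - k) * n))); last first.
  move=> V fV; rewrite mul1r -natrX -(card_mulmx_eq0 n fV); congr _%:R.
  by apply: eq_card => M; rewrite !inE.
have -> : \sum_(V : 'M[F]_(k, n) | row_free V) 1 * q ^+ ((n - k) * n) =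
    qfall q n k * q ^+ ((n - k) * n).
  rewrite -mulr_suml -card_row_free natr_card_set big_mkcond; congr (_ * _).
  by apply: eq_bigr => V _; case: (row_free V).
rewrite cardsT card_mx natrX.
have q0 m : q ^+ m != 0 by rewrite expf_neq0 // gt_eqF // card_field_gt0.
case: (leqP k n) => [kn|nk]; last by rewrite qfall_eq0 // !mul0r.
apply/eqP; rewrite eqr_div //; apply/eqP; rewrite -mulrA -exprD.
by congr (_ * _ ^+ _); rewrite mulnBl [(n * k)%N]mulnC subnK // leq_mul.
Qed.

Definition isotropic n (C : 'M[F]_n) k : {set 'M[F]_(k, n)} :=
  [set V | row_free V && (V *m C *m V^T == 0)].

Lemma mean_qfall_corank_Csymmetric n k (C : 'M[F]_n) : alternating_mx C ->
  (\sum_(M in Csymmetric C) qfall q (n - \rank M) k) / #|Csymmetric C|%:R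
    = #|isotropic C k|%:R * q ^+ 'C(k, 2) / q ^+ (n * k).
Proof.
move=> altC; rewrite sum_qfall_corank card_Csymmetric // natrX.
rewrite (eq_bigr (fun V : 'M[F]_(k, n) =>
    (V *m C *m V^T == 0)%:R * q ^+ 'C((n - k).+1, 2))); last first.
  by move=> V fV; rewrite card_Csymmetric_mulmx_eq0 // natrM natrX.
rewrite -mulr_suml.
have -> : \sum_(V : 'M[F]_(k, n) | row_free V) (V *m C *m V^T == 0)%:R =
    #|isotropic C k|%:R :> rat.
  rewrite natr_card_set [LHS]big_mkcond /=; apply: eq_bigr => V _.
  by case: (row_free V).
have q0 m : q ^+ m != 0 by rewrite expf_neq0 // gt_eqF // card_field_gt0.
case: (leqP k n) => [kn|nk]; last first.
  rewrite [isotropic C k](_ : _ = set0) ?cards0 ?mul0r //.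
  apply/setP => V; rewrite !inE; apply/negbTE/negP => /andP[/row_free_le].
  by rewrite leqNgt nk.
apply/eqP; rewrite eqr_div //; apply/eqP; rewrite -!mulrA -!exprD.
(* What remains is C(n-k+1,2) + nk = C(k,2) + C(n+1,2), by induction on n - k. *)
congr (_ * _ ^+ _); rewrite -{2 3}(subnKC kn); move: (n - k)%N => m.
elim: m => [|m IH].
  rewrite addn0 bin_small // add0n; elim: (k) => // j IH.
  by move: IH; rewrite !(binS _ 1) !bin1; nia.
rewrite [in LHS](binS m.+1 1) bin1 !addnS.
by rewrite [in RHS](binS (k + m).+1 1) bin1; nia.
Qed.

(** * Isotropic tuples for a form of rank c: recursion and approximation *)

Variables (n c : nat) (C : 'M[F]_n).
Hypotheses (altC : alternating_mx C) (rankC : \rank C = c).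
Local Notation N k := (#|isotropic C k|%:R : rat).

(** Counts pairs of an isotropic V and a nonzero vector of its span lying in ker C; it measures the
    excess over the generic number of extensions. *)
Definition defect k : rat :=
  \sum_(V in isotropic C k) (q ^+ (k - \rank (V *m C)) - 1).

Lemma card_isotropic0 : N 0 = 1.
Proof.
rewrite [X in X%:R](_ : _ = 1%N) // -(card1 (0 : 'M[F]_(0, n))).
apply: eq_card => V; rewrite !inE [V]flatmx0 eqxx /row_free mxrank0 eqxx.
by rewrite [X in X == 0]flatmx0 eqxx.
Qed.

Lemma card_isotropic_le k : N k <= qfall q n k.
Proof.
rewrite -card_row_free ler_nat; apply: subset_leq_card.
by apply/subsetP => V; rewrite !inE => /andP[].
Qed.

(** The corner v C v^T vanishes and the off-diagonal blocks determine each other, so isotropy puts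
    only linear conditions on v. *)
Lemma isotropic_col_mx k (v : 'rV[F]_n) (V : 'M[F]_(k, n)) :
  (col_mx v V \in isotropic C (1 + k)) =
  (V \in isotropic C k) && ((v *m (V *m C)^T == 0) && ~~ (v <= V)%MS).
Proof.
have [CT _] := altC.
rewrite !inE row_free_col_mx mul_col_mx tr_col_mx mul_col_row.
rewrite alternating_mx_self // trmx_mul CT mulNmx mulmxN oppr_eq0 mulmxA.
set W := V *m C *m V^T; set x := v *m C *m V^T.
have -> : V *m C *m v^T = - x^T by rewrite /x !trmx_mul trmxK CT mulNmx mulmxN opprK mulmxA.
have -> : (block_mx 0 x (- x^T) W == 0) = (W == 0) && (x == 0).
  apply/eqP/andP => [|[/eqP-> /eqP->]]; last by rewrite trmx0 oppr0 block_mx0.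
  by rewrite -[0 in RHS]block_mx0 => /eq_block_mx[_ -> _ ->].
by case: (row_free V); case: (v <= V)%MS; rewrite ?andbF ?andbT.
Qed.

(** The new vector ranges over the orthogonal of V, of dimension n - rank(V C), minus the span of V,
    which lies inside it by isotropy. *)
Lemma card_isotropicS k : (k <= n)%N ->
  N k.+1 = N k * (q ^+ (n - k) - q ^+ k) + q ^+ (n - k) * defect k.
Proof.
move=> kn; transitivity (\sum_(V in isotropic C k)
    (q ^+ (n - \rank (V *m C)) - q ^+ k)); last first.
  rewrite /defect mulr_sumr -sum1_card natr_sum mulr_suml -big_split /=.
  apply: eq_bigr => V _.
  have rk := rank_leq_row (V *m C).
  have -> : (n - \rank (V *m C) = (n - k) + (k - \rank (V *m C)))%N by lia.
  by rewrite exprD; ring.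
rewrite -sum1_card natr_sum big_mkcond /= -[k.+1]/(1 + k)%N sum_col_mx.
rewrite [RHS]big_mkcond /=; apply: eq_bigr => V _.
under eq_bigr => v _ do rewrite isotropic_col_mx.
have [VI|VI] /= := boolP (V \in _); last by rewrite big1.
move: VI; rewrite inE => /andP[fV /eqP V0].
have := card_submx V; rewrite (eqP fV) -(mxrank_tr (V *m C)) => cV.
rewrite -!natrX -card_kermx -cV !natr_card_set -sumrB; apply: eq_bigr => v _.
have [/submxP[w ->]|vV] := boolP (v <= V)%MS; last first.
  by rewrite subr0 andbT; case: ifP.
have [CT _] := altC.
by rewrite andbF trmx_mul CT mulNmx mulmxN oppr_eq0 mulmxA -(mulmxA w) -(mulmxA w) V0 mulmx0 eqxx subrr.
Qed.

Lemma defect_ge0 k : 0 <= defect k.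
Proof.
apply: sumr_ge0 => V _; rewrite subr_ge0 exprn_ege1 //.
exact/ltW/card_field_gt1.
Qed.

Lemma defect0 : defect 0 = 0.
Proof. by rewrite /defect big1 // => V _; rewrite expr0 subrr. Qed.

Lemma row_free_row' m (V : 'M[F]_(m, n)) p : row_free V -> row_free (row' p V).
Proof.
move=> /row_freeP[B VB]; apply/row_freeP; exists (col' p B).
rewrite row'Esub col'Esub -mxsub_mul VB.
by apply/matrixP => i j; rewrite !mxE (inj_eq lift_inj).
Qed.

(** Depends on w alone, so the deleted row can be located again from w; the default is reached only
    at w = 0. *)
Definition pivot m (w : 'rV[F]_m.+1) : 'I_m.+1 :=
  odflt ord0 [pick p | w 0 p != 0].

Lemma pivot_neq0 m (w : 'rV[F]_m.+1) : w != 0 -> w 0 (pivot w) != 0.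
Proof.
move=> w0; rewrite /pivot; case: pickP => //= w_eq0.
by case/eqP: w0; apply/rowP => j; rewrite mxE; apply/eqP/negbFE/w_eq0.
Qed.

(* A pair (V, w) with w nonzero and w V in ker C is determined by w, by w V, and
   by V with the row at a nonzero entry of w deleted. *)
Lemma defect_le k : defect k.+1 <= q ^+ k.+1 * q ^+ (n - c) * qfall q n k.
Proof.
pose S := [set x : 'M[F]_(k.+1, n) * 'rV[F]_k.+1 |
            [&& row_free x.1, x.2 != 0 & x.2 *m x.1 *m C == 0]].
pose f (x : 'M[F]_(k.+1, n) * 'rV[F]_k.+1) :=
  (x.2, x.2 *m x.1, row' (pivot x.2) x.1).
pose B := setX (setX [set: 'rV[F]_k.+1] [set v : 'rV[F]_n | v *m C == 0])
               [set V : 'M[F]_(k, n) | row_free V].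
have f_inj : {in S &, injective f}.
  move=> [V w] [V' w']; rewrite !inE /= => /and3P[_ w0 _] _ [<- wV rV].
  have rVE := @row'_eq _ k.+1 n (pivot w) V V' rV.
  congr pair; apply/matrixP => i j.
  have [->|ip] := eqVneq i (pivot w); last by rewrite rVE.
  have := congr1 (fun X : 'rV_n => X 0 j) wV; rewrite !mxE.
  rewrite !(bigD1_ord (pivot w)) //= => E.
  apply: (mulfI (pivot_neq0 w0)); move: E.
  rewrite [X in _ + X](eq_bigr (fun i => w 0 (lift (pivot w) i) * V' (lift (pivot w) i) j)).
    exact: addIr.
  by move=> l _; rewrite rVE // inE eq_sym neq_lift.
have SB : f @: S \subset B.
  apply/subsetP => y /imsetP[[V w]]; rewrite inE /= => /and3P[fV _ wV ->].
  by rewrite !inE /= wV; exact: (row_free_row' (pivot w) fV).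
have leSB : #|S|%:R <= #|B|%:R :> rat.
  by rewrite ler_nat -(card_in_imset f_inj) subset_leq_card.
have -> : q ^+ k.+1 * q ^+ (n - c) * qfall q n k = #|B|%:R.
  by rewrite !cardsX cardsT card_mx card_kermx rankC !natrM !natrX card_row_free mul1n.
apply: le_trans leSB; rewrite natr_card_set /=.
rewrite -(pair_big predT predT (fun V w => ([&& row_free V, w != 0 & w *m V *m C == 0])%:R)) /=.
rewrite /defect big_mkcond /=; apply: ler_sum => V _.
rewrite inE; have [fV|] /= := boolP (row_free V); last by move=> _; rewrite sumr_ge0.
have -> : \sum_(w : 'rV[F]_k.+1) (((w != 0) && (w *m V *m C == 0))%:R : rat) =
    q ^+ (k.+1 - \rank (V *m C)) - 1.
  rewrite -natrX -card_kermx natr_card_set [in RHS](bigD1 0) //= mul0mx eqxx.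
  rewrite [RHS]addrAC subrr add0r [LHS](bigD1 0) //= eqxx add0r; apply: eq_bigr => w w0.
  by rewrite w0 mulmxA.
(* Isotropy is dropped here: other V contribute nonnegative counts. *)
case: ifP => // _; rewrite subr_ge0 exprn_ege1 //; exact/ltW/card_field_gt1.
Qed.

(** Trades a power q^n for a factor of [qfall] at the cost of a factor 2. *)
Lemma half_le_exprB k : (k < n)%N -> q ^+ n <= 2 * (q ^+ n - q ^+ k).
Proof.
move=> kn; rewrite -(subnKC kn) exprD exprS.
have q2 := card_field_ge2 F.
have q1 : 1 <= q by lra.
have := exprn_ege1 k q1; have := exprn_ege1 (n - k.+1) q1.
set a := q ^+ k; set b := q ^+ (n - _) => b1 a1.
have : 0 <= (q - 2) * (a * b) by rewrite !mulr_ge0; lra.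
nra.
Qed.

Lemma card_isotropic_approx k : (k <= n)%N ->
  `|N k * q ^+ 'C(k, 2) - qfall q n k|
    <= 4 * q ^+ 'C(k.+1, 2) / q ^+ c * qfall q n k.
Proof.
have q0 := card_field_gt0; have q2 := card_field_ge2 F.
have q1 : 1 <= q by lra.
have cn : (c <= n)%N by rewrite -rankC rank_leq_col.
elim: k => [_|k IH kn].
  rewrite card_isotropic0 bin0n /qfall big_ord0 mul1r subrr normr0.
  by rewrite mulr1 divr_ge0 ?mulr_ge0 ?exprn_ge0 // ltW.
have {}IH := IH (ltnW kn).
rewrite card_isotropicS ?(ltnW kn) // qfallS.
have E2 : q ^+ 'C(k.+1, 2) = q ^+ 'C(k, 2) * q ^+ k by rewrite binS bin1 exprD.
have E3 : q ^+ 'C(k.+2, 2) = q ^+ 'C(k.+1, 2) * (q * q ^+ k).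
  by rewrite binS bin1 exprD exprS.
have En : q ^+ (n - k) * q ^+ k = q ^+ n by rewrite -exprD subnK // ltnW.
have half := half_le_exprB kn.
have NG := card_isotropic_le k.
rewrite E3 E2 in IH *.
(* Three sources of error: the inherited one, the gap between q^(2k) and q^k in the generic factor,
   and the defect. *)
have -> : (N k * (q ^+ (n - k) - q ^+ k) + q ^+ (n - k) * defect k) *
    (q ^+ 'C(k, 2) * q ^+ k) - qfall q n k * (q ^+ n - q ^+ k) =
  (N k * q ^+ 'C(k, 2) - qfall q n k) * (q ^+ n - q ^+ k)
  - N k * q ^+ 'C(k, 2) * (q ^+ k * (q ^+ k - 1))
  + q ^+ n * defect k * q ^+ 'C(k, 2).
  by rewrite -En; ring.
(* The first vector produces no error. Afterwards x = q^k >= 2, and the three errors add up to a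
   multiple 8 + 2x <= 4qx, which closes the induction. *)
case: k IH kn E2 E3 En half NG => [|k] IH kn E2 E3 En half NG.
  rewrite defect0 card_isotropic0 bin0n /qfall big_ord0 !expr0 in IH *.
  rewrite !(mulr1, mul1r, mulr0, mul0r, subrr, addr0) normr0.
  rewrite mulr_ge0 ?divr_ge0 ?mulr_ge0 ?exprn_ge0 ?(ltW q0) //.
  by rewrite subr_ge0 exprn_ege1.
set B := q ^+ 'C(k.+1, 2) in IH E2 E3 *; set G := qfall q n k.+1 in IH NG *.
set s := q ^+ n - q ^+ k.+1 in half *.
have B0 : 0 < B by rewrite exprn_gt0.
have G0 : 0 <= G by apply: qfall_ge0; lra.
have qn0 : 0 < q ^+ n by rewrite exprn_gt0.
have s0 : 0 < s by lra.
have c0 : 0 < q ^+ c by rewrite exprn_gt0.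
have x2 : 2 <= q ^+ k.+1 by rewrite exprS; have := exprn_ege1 k q1; nra.
set x := q ^+ k.+1 in x2 IH E2 E3 *.
have N0 : 0 <= N k.+1 by [].
have y0 : 0 < (q ^+ c)^-1 by rewrite invr_gt0.
(* From q^c <= q^n <= 2s: the second error has no q^-c of its own and borrows it from the factor
   s. *)
have sy : 1 <= 2 * s * (q ^+ c)^-1.
  rewrite ler_pdivlMr // mul1r; apply: le_trans half.
  by rewrite ler_weXn2l.
have T2 : `|N k.+1 * B * (x * (x - 1))| <= 2 * (B * x * x) / q ^+ c * (G * s).
  rewrite ger0_norm; last by rewrite !mulr_ge0 //; lra.
  have -> : 2 * (B * x * x) / q ^+ c * (G * s) = G * (B * x * x) * (2 * s / q ^+ c) by ring.
  apply: (@le_trans _ _ (G * (B * x * x))); last first.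
    by rewrite ler_peMr // !mulr_ge0 //; lra.
  rewrite -!mulrA ler_pM ?mulr_ge0 //; try lra.
  by rewrite ler_pM2l //; nra.
(* The 4 comes from q^n q^n <= (2s')(2s), which restores the two last factors of [qfall]. *)
have T3 : `|q ^+ n * defect k.+1 * B| <= 4 * (B * x) / q ^+ c * (G * s).
  rewrite ger0_norm; last by rewrite !mulr_ge0 ?defect_ge0 //; lra.
  have half' := half_le_exprB (ltnW kn).
  have := defect_le k; rewrite -/x.
  have -> : q ^+ (n - c) = q ^+ n / q ^+ c.
    by rewrite -[in q ^+ n](subnK cn) exprD mulfK // gt_eqF.
  rewrite /G qfallS; set H := qfall q n k; set s' := q ^+ n - q ^+ k in half' *.
  have H0 : 0 <= H by apply: qfall_ge0; lra.
  move=> dle; apply: (@le_trans _ _ (q ^+ n * (x * (q ^+ n / q ^+ c) * H) * B)).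
    by rewrite ler_pM2r // ler_pM2l.
  have -> : q ^+ n * (x * (q ^+ n / q ^+ c) * H) * B =
     (x * H * B / q ^+ c) * (q ^+ n * q ^+ n) by ring.
  have -> : 4 * (B * x) / q ^+ c * (H * s' * s) =
     (x * H * B / q ^+ c) * ((2 * s') * (2 * s)) by ring.
  rewrite ler_wpM2l ?mulr_ge0 //; try lra.
  by rewrite ler_pM //; lra.
apply: le_trans (ler_normD _ _) _; apply: le_trans (lerD (ler_normB _ _) (lexx _)) _.
rewrite normrM (gtr0_norm s0).
apply: (@le_trans _ _ (4 * (B * x) / q ^+ c * G * s + 2 * (B * x * x) / q ^+ c * (G * s) +
  4 * (B * x) / q ^+ c * (G * s))).
  by rewrite !lerD // ler_pM2r.
have -> : 4 * (B * x) / q ^+ c * G * s + 2 * (B * x * x) / q ^+ c * (G * s) +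
  4 * (B * x) / q ^+ c * (G * s) = (B * x / q ^+ c * (G * s)) * (8 + 2 * x) by ring.
have -> : 4 * (B * x * (q * x)) / q ^+ c * (G * s) =
  (B * x / q ^+ c * (G * s)) * (4 * (q * x)) by ring.
by rewrite ler_wpM2l ?mulr_ge0 //; try lra; nra.
Qed.

End Moments.

(** * From moments to the law of the corank *)

Lemma unif_prob_corank (F : finFieldType) n r (A : {set 'M[F]_n}) :
  unif_prob A (corank_set F n r) =
  \sum_(i < n.+1) inv_coef #|F|%:R r i *
    ((\sum_(M in A) qfall #|F|%:R (n - \rank M) (r + i)) / #|A|%:R).
Proof.
transitivity ((\sum_(M in A) ((n - \rank M)%N == r)%:R) / #|A|%:R : rat).
  congr (_ / _); rewrite -sum1_card natr_sum [LHS]big_mkcond [RHS]big_mkcond /=.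
  apply: eq_bigr => M _; rewrite !inE /dim_ker mxrank_ker mxrank_tr.
  by case: (M \in A); case: eqP.
(* Coranks are at most n, so n + 1 terms of the inversion suffice; they account for the factor n in
   the final bound. *)
under eq_bigr => M _.
  rewrite -(@qfall_inversion _ #|F|%:R r _ n (card_field_gt1 F)); last first.
    by rewrite (leq_trans (leq_subr _ _)) // leq_addl.
over.
rewrite exchange_big mulr_suml /=; apply: eq_bigr => i _.
by rewrite -mulr_sumr mulrA.
Qed.

Lemma bin2_addnS (r i : nat) :
  'C((r + i).+1, 2) = ('C(r.+1, 2) + 'C(i.+1, 2) + r * i)%N.
Proof.
elim: i => [|i IH]; first by rewrite addn0 muln0 !addn0.
by rewrite addnS (binS (r + i).+1 1) (binS i.+1 1) !bin1 IH; nia.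
Qed.

(** For k <= n, divide [card_isotropic_approx] by q^(nk) and use [qfall_le]; for k > n both moments
    vanish. *)
Lemma moment_diff_le (F : finFieldType) n k (C : 'M[F]_n) :
  alternating_mx C ->
  `|(\sum_(M in Csymmetric C) qfall (#|F|%:R : rat) (n - \rank M) k)
        / #|Csymmetric C|%:R -
    (\sum_(M in [set: 'M[F]_n]) qfall #|F|%:R (n - \rank M) k)
        / #|[set: 'M[F]_n]|%:R|
  <= 4 * #|F|%:R ^+ 'C(k.+1, 2) / #|F|%:R ^+ \rank C.
Proof.
move=> altC; rewrite mean_qfall_corank mean_qfall_corank_Csymmetric //.
have q0 := card_field_gt0 F; have q1 := card_field_gt1 F.
rewrite -mulrBl normrM normfV [`|_ ^+ (n * k)|]ger0_norm ?exprn_ge0 ?(ltW q0) //.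
have a0 : 0 <= 4 * #|F|%:R ^+ 'C(k.+1, 2) / #|F|%:R ^+ \rank C :> rat.
  by rewrite divr_ge0 ?mulr_ge0 ?exprn_ge0 // ltW.
rewrite ler_pdivrMr ?exprn_gt0 //; case: (leqP k n) => [kn|nk].
  apply: le_trans (card_isotropic_approx altC erefl kn) _.
  by rewrite ler_wpM2l // qfall_le.
have N0 := card_isotropic_le C k.
rewrite qfall_eq0 // in N0 *.
have -> : #|isotropic C k|%:R = 0 :> rat by apply/le_anti; rewrite N0 ler0n.
by rewrite mul0r subrr normr0 mulr_ge0 ?exprn_ge0 ?(ltW q0).
Qed.

Theorem theorem3p13 (ell r : nat) (hell : prime_power ell) :
  exists (K : rat) (n0 c0 : nat),
    forall F : finFieldType, #|F| = ell ->
    forall n c : nat, (n0 <= n)%N -> (c0 <= c)%N -> ~~ odd c ->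
    forall C : 'M[F]_n, alternating_mx C -> \rank C = c ->
      `| unif_prob (Csymmetric C) (corank_set F n r) - p_ker F r n |
        <= K * (n%:R * (ell%:R ^+ c)^-1).
Proof.
(* 32 = 4 * 4 * 2: a 4 from [inv_coef_le], a 4 from [moment_diff_le], and a 2 from n + 1 <= 2n,
   valid for n >= 1. *)
exists (32 * ell%:R ^+ 'C(r.+1, 2)), 1%N, 0%N => F <- n c n1 _ _ C altC rC.
rewrite /p_ker !unif_prob_corank -sumrB.
apply: le_trans (ler_norm_sum _ _ _) _.
set q : rat := #|F|%:R.
have q2 : 2 <= q := card_field_ge2 F; have q0 : 0 < q := card_field_gt0 F.
pose b : rat := 16 * q ^+ 'C(r.+1, 2) / q ^+ c.
apply: (@le_trans _ _ (\sum_(i < n.+1) b)); last first.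
  rewrite sumr_const card_ord -[_ *+ n.+1]mulr_natl /b.
  have -> : 32 * q ^+ 'C(r.+1, 2) * (n%:R * (q ^+ c)^-1) =
      2 * n%:R * (16 * q ^+ 'C(r.+1, 2) / q ^+ c) by ring.
  rewrite ler_wpM2r ?divr_ge0 ?mulr_ge0 ?exprn_ge0 ?(ltW q0) //.
  by rewrite -natrM ler_nat; lia.
apply: ler_sum => i _; rewrite -mulrBr normrM.
apply: le_trans (ler_pM _ _ (inv_coef_le r i q2) (moment_diff_le (r + i) altC)) _;
  rewrite ?normr_ge0 //.
(* Splitting C(r+i+1,2) makes all powers depending on i cancel, so the bound for each term is
   exactly [b]. *)
rewrite rC -/q bin2_addnS (exprD _ ('C(r.+1, 2) + 'C(i.+1, 2))) (exprD _ 'C(r.+1, 2)) /b.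
rewrite le_eqVlt; apply/orP; left; apply/eqP.
have qn m : q ^+ m != 0 by rewrite expf_neq0 // gt_eqF.
move: (qn (r * i)%N) (qn 'C(i.+1, 2)) (qn c).
move: (q ^+ (r * i)) (q ^+ 'C(i.+1, 2)) (q ^+ c) (q ^+ 'C(r.+1, 2)).
move=> x y z t x0 y0 z0.
by field; rewrite x0 y0 z0.
Qed.
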